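(* Let $G$ be a group such that $H_2(G)$ is torsion-free, and let $1 \to A \to K \to G \to 1$ be a central extension of $G$. If $K$ is circularly orderable, then the exterior square $G \wedge G$ is circularly orderable. If $K$ is left-orderable, then $G \wedge G$ is left-orderable.
   Context: A group $G$ is left-orderable if it admits a total order $<$ such that $g_1<g_2 \Leftrightarrow hg_1<hg_2$ for all $h,g_1,g_2\in G$. A group $G$ is circularly orderable if there is a map $c: G^3\to\mathbb{Z}$ such that: (1) $c$ takes values in $\{-1,0,1\}$; (2) $c(g_1,g_2,g_3)=0$ if and only if $g_i=g_j$ for some $i\neq j$; (3) $c(g_2,g_3,g_4)-c(g_1,g_3,g_4)+c(g_1,g_2,g_4)-c(g_1,g_2,g_3)=0$ for all $g_1,\dots,g_4\in G$; (4) $c(g_1,g_2,g_3)=c(hg_1,hg_2,hg_3)$ for all $h,g_1,g_2,g_3\in G$. The (non-abelian) tensor square $G\otimes G$ is the group generated by symbols $g\otimes h$ ($g,h\in G$) subject to the relations $gh\otimes k=({}^gh\otimes{}^gk)(g\otimes k)$ and $g\otimes hk=(g\otimes h)({}^hg\otimes{}^hk)$ for all $g,h,k \in G$, where ${}^gh:=ghg^{-1}$. The exterior square $G\wedge G$ is the quotient of $G\otimes G$ by the normal subgroup generated by $\{g\otimes g \mid g\in G\}$. $H_2(G)$ denotes the second integral group homology of $G$ with trivial action. *)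

(* Defs.v *)
From HB Require Import structures.
From mathcomp Require Import all_boot all_order all_algebra ssrAC.
From mathcomp Require Import monoid generic_quotient ring_quotient.
From mathcomp Require Import boolp.
From mathcomp Require Import freeg.

Set Implicit Arguments.
Unset Strict Implicit.
Unset Printing Implicit Defensive.

Import GRing.Theory.

Local Open Scope quotient_scope.
Local Open Scope group_scope.

(* A [groupType] may be infinite; it carries a choice structure, which every
   type has by the axioms of boolp. *)

Definition left_orderable (G : groupType) : Prop :=
  exists lt : rel G,
    [/\ irreflexive lt,
        transitive lt,
        forall x y, x != y -> lt x y || lt y x &
        forall h g1 g2 : G, lt g1 g2 <-> lt (h * g1) (h * g2)].

Definition circularly_orderable (G : groupType) : Prop :=
  exists c : G -> G -> G -> int,
    [/\ forall g1 g2 g3, c g1 g2 g3 \in [:: (-1)%R; 0%R; 1%R],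
        forall g1 g2 g3,
          c g1 g2 g3 = 0%R <-> [\/ g1 = g2, g1 = g3 | g2 = g3],
        forall g1 g2 g3 g4,
          (c g2 g3 g4 - c g1 g3 g4 + c g1 g2 g4 - c g1 g2 g3 = 0)%R &
        forall h g1 g2 g3 : G,
          c g1 g2 g3 = c (h * g1) (h * g2) (h * g3)].

Definition central_extension (A K G : groupType)
    (i : {multiplicative A -> K}) (p : {multiplicative K -> G}) : Prop :=
  [/\ injective i,
      forall g : G, exists k : K, p k = g,
      forall k : K, p k = 1 <-> exists a : A, i a = k &
      forall (a : A) (k : K), commute (i a) k].

Section Presentation.
Variable X : choiceType.

(* The letter (false, x) stands for x and (true, x) for its inverse. *)
Definition word := seq (bool * X).

Variable rels : word -> word -> Prop.

Inductive pres_cong : word -> word -> Prop :=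
| pres_refl u : pres_cong u u
| pres_sym u v : pres_cong u v -> pres_cong v u
| pres_trans u v w : pres_cong u v -> pres_cong v w -> pres_cong u w
| pres_cat u u' v v' :
    pres_cong u u' -> pres_cong v v' -> pres_cong (u ++ v) (u' ++ v')
| pres_cancel b x : pres_cong [:: (b, x); (~~ b, x)] [::]
| pres_rels u v : rels u v -> pres_cong u v.

Definition pres_eq (u v : word) : bool := `[< pres_cong u v >].

Fact pres_eq_equiv : equiv_class_of pres_eq.
Proof.
split=> [u|u v|v u w].
- by apply/asboolP; exact: pres_refl.
- by apply/asboolP/asboolP; exact: pres_sym.
- by move=> /asboolP uv /asboolP vw; apply/asboolP; exact: pres_trans vw.
Qed.

Canonical pres_equiv_rel := EquivRelPack pres_eq_equiv.
Canonical pres_enc_mod_rel := defaultEncModRel pres_eq.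

Definition presented := {eq_quot pres_eq}.
HB.instance Definition _ : EqQuotient word pres_eq presented :=
  EqQuotient.on presented.
HB.instance Definition _ := Choice.on presented.

(* [\pi_presented] used directly leaves coercions that block rewriting. *)
Definition pres_class (u : word) : presented := \pi_presented u.

Lemma pres_classK (x : presented) : pres_class (repr x) = x.
Proof. exact: reprK. Qed.

Lemma presentedP (u v : word) :
  pres_class u = pres_class v <-> pres_cong u v.
Proof.
by split=> [/eqmodP/asboolP //|uv]; apply/eqmodP/asboolP.
Qed.

Definition word_inv (u : word) : word :=
  rev [seq (~~ l.1, l.2) | l <- u].

Lemma pres_mulVw u : pres_cong (word_inv u ++ u) [::].
Proof.
elim: u => [|[b x] u IHu]; first exact: pres_refl.
rewrite /word_inv /= rev_cons cat_rcons -/(word_inv u).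
apply: pres_trans IHu; apply: pres_cat; first exact: pres_refl.
rewrite -[in X in pres_cong X _](cat1s (b, x)) -cat_cons.
rewrite -[X in pres_cong _ X]cat0s; apply: pres_cat; last exact: pres_refl.
by rewrite -{2}[b]negbK; exact: pres_cancel.
Qed.

Lemma word_invK : involutive word_inv.
Proof.
move=> u; rewrite /word_inv map_rev revK -map_comp map_id_in // => -[b x] _.
by rewrite /= negbK.
Qed.

Lemma pres_mulwV u : pres_cong (u ++ word_inv u) [::].
Proof. by rewrite -{1}[u]word_invK; exact: pres_mulVw. Qed.

Lemma pres_inv u v : pres_cong u v -> pres_cong (word_inv u) (word_inv v).
Proof.
move=> uv; have /(pres_cat (pres_refl (word_inv u))) := pres_mulwV v.
rewrite cats0 => /pres_sym /pres_trans; apply.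
rewrite catA -[X in pres_cong _ X]cat0s; apply: pres_cat (pres_refl _).
apply: pres_trans (pres_mulVw u); apply: pres_cat; first exact: pres_refl.
exact: pres_sym.
Qed.

Definition pres_one : presented := pres_class [::].
Definition pres_mul (x y : presented) : presented := pres_class (repr x ++ repr y).
Definition pres_invg (x : presented) : presented := pres_class (word_inv (repr x)).

Lemma pres_repr u : pres_cong (repr (pres_class u)) u.
Proof. by apply/presentedP; rewrite pres_classK. Qed.

Lemma pres_piM u v :
  pres_mul (pres_class u) (pres_class v) = pres_class (u ++ v).
Proof. by apply/presentedP; apply: pres_cat; exact: pres_repr. Qed.

Lemma pres_piV u : pres_invg (pres_class u) = pres_class (word_inv u).
Proof. by apply/presentedP; apply: pres_inv; exact: pres_repr. Qed.

Fact pres_mulA : associative pres_mul.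
Proof.
move=> x y z; rewrite -[x]pres_classK -[y]pres_classK -[z]pres_classK.
by rewrite !pres_piM catA.
Qed.

Fact pres_mul1 : left_id pres_one pres_mul.
Proof. by move=> x; rewrite -[x]pres_classK pres_piM. Qed.

Fact pres_mulr1 : right_id pres_one pres_mul.
Proof. by move=> x; rewrite -[x]pres_classK pres_piM cats0. Qed.

Fact pres_mulV : left_inverse pres_one pres_invg pres_mul.
Proof.
move=> x; rewrite -[x]pres_classK pres_piV pres_piM.
by apply/presentedP; exact: pres_mulVw.
Qed.

Fact pres_mulrV : right_inverse pres_one pres_invg pres_mul.
Proof.
move=> x; rewrite -[x]pres_classK pres_piV pres_piM.
by apply/presentedP; exact: pres_mulwV.
Qed.

HB.instance Definition _ := isGroup.Build presented
  pres_mulA pres_mul1 pres_mulr1 pres_mulV pres_mulrV.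

Definition pres_gen (x : X) : presented := pres_class [:: (false, x)].

End Presentation.

Section NormalQuotient.
Variables (G : groupType) (S : G -> Prop).

Definition normal_subgroup (N : G -> Prop) : Prop :=
  [/\ N 1,
      forall x y, N x -> N y -> N (x * y),
      forall x, N x -> N x^-1 &
      forall x g, N x -> N (g * x * g^-1)].

Definition normal_closure (x : G) : Prop :=
  forall N, normal_subgroup N -> (forall s, S s -> N s) -> N x.

Fact normal_closure_normal : normal_subgroup normal_closure.
Proof.
split=> [N []//|x y Nx Ny N nN SN|x Nx N nN SN|x g Nx N nN SN].
- by case: (nN) => _ + _ _; apply; [exact: Nx|exact: Ny].
- by case: (nN) => _ _ + _; apply; exact: Nx.
- by case: (nN) => _ _ _; apply; exact: Nx.
Qed.

Definition nquo_eq (x y : G) : bool := `[< normal_closure (x * y^-1) >].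

Fact nquo_eq_equiv : equiv_class_of nquo_eq.
Proof.
have [N1 NM NV _] := normal_closure_normal.
split=> [x|x y|y x z].
- by apply/asboolP; rewrite mulgV.
- by apply/asboolP/asboolP => /NV; rewrite invgM invgK.
- move=> /asboolP xy /asboolP yz; apply/asboolP.
  by have := NM _ _ xy yz; rewrite mulgA mulgVK.
Qed.

Canonical nquo_equiv_rel := EquivRelPack nquo_eq_equiv.
Canonical nquo_enc_mod_rel := defaultEncModRel nquo_eq.

Definition nquo := {eq_quot nquo_eq}.
HB.instance Definition _ : EqQuotient G nquo_eq nquo := EqQuotient.on nquo.
HB.instance Definition _ := Choice.on nquo.

Definition nquo_class (x : G) : nquo := \pi_nquo x.

Lemma nquo_classK (x : nquo) : nquo_class (repr x) = x.
Proof. exact: reprK. Qed.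

Lemma nquoP (x y : G) :
  nquo_class x = nquo_class y <-> normal_closure (x * y^-1).
Proof. by split=> [/eqmodP/asboolP //|xy]; apply/eqmodP/asboolP. Qed.

Definition nquo_one : nquo := nquo_class 1.
Definition nquo_mul (x y : nquo) : nquo := nquo_class (repr x * repr y).
Definition nquo_inv (x : nquo) : nquo := nquo_class ((repr x)^-1).

Lemma nquo_repr x : normal_closure (repr (nquo_class x) * x^-1).
Proof. by apply/nquoP; rewrite nquo_classK. Qed.

Lemma nquo_piM x y : nquo_mul (nquo_class x) (nquo_class y) = nquo_class (x * y).
Proof.
have [_ NM _ NJ] := normal_closure_normal; apply/nquoP.
have := NM _ _ (NJ _ (repr (nquo_class x)) (nquo_repr y)) (nquo_repr x).
by rewrite !mulgA mulgVK invgM !mulgA.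
Qed.

Lemma nquo_piV x : nquo_inv (nquo_class x) = nquo_class (x^-1).
Proof.
have [_ _ NV NJ] := normal_closure_normal; apply/nquoP.
have := NJ _ (repr (nquo_class x))^-1 (NV _ (nquo_repr x)).
by rewrite invgM !invgK !mulgA mulgVK.
Qed.

Fact nquo_mulA : associative nquo_mul.
Proof.
move=> x y z; rewrite -[x]nquo_classK -[y]nquo_classK -[z]nquo_classK.
by rewrite !nquo_piM mulgA.
Qed.

Fact nquo_mul1 : left_id nquo_one nquo_mul.
Proof. by move=> x; rewrite -[x]nquo_classK nquo_piM mul1g. Qed.

Fact nquo_mulr1 : right_id nquo_one nquo_mul.
Proof. by move=> x; rewrite -[x]nquo_classK nquo_piM mulg1. Qed.

Fact nquo_mulV : left_inverse nquo_one nquo_inv nquo_mul.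
Proof. by move=> x; rewrite -[x]nquo_classK nquo_piV nquo_piM mulVg. Qed.

Fact nquo_mulrV : right_inverse nquo_one nquo_inv nquo_mul.
Proof. by move=> x; rewrite -[x]nquo_classK nquo_piV nquo_piM mulgV. Qed.

HB.instance Definition _ := isGroup.Build nquo
  nquo_mulA nquo_mul1 nquo_mulr1 nquo_mulV nquo_mulrV.

End NormalQuotient.

Section ExteriorSquare.
Variable G : groupType.

(* [x ^ y] in the library is y^-1 * x * y, so ^g h has to be defined. *)
Definition lconjg (g h : G) : G := g * h * g^-1.

Definition tensor_letter (g h : G) : bool * (G * G) := (false, (g, h)).

Inductive tensor_rels : word (G * G)%type -> word (G * G)%type -> Prop :=
| tensor_relMl g h k :
    tensor_rels [:: tensor_letter (g * h) k]
      [:: tensor_letter (lconjg g h) (lconjg g k); tensor_letter g k]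
| tensor_relMr g h k :
    tensor_rels [:: tensor_letter g (h * k)]
      [:: tensor_letter g h; tensor_letter (lconjg h g) (lconjg h k)].

Definition tensor_square : groupType := presented tensor_rels.

Definition tensor (g h : G) : tensor_square := pres_gen tensor_rels (g, h).

Definition exterior_square : groupType :=
  nquo (fun t : tensor_square => exists g : G, t = tensor g g).

End ExteriorSquare.

Section SecondHomology.
Variable G : groupType.

Local Open Scope ring_scope.

(* Inhomogeneous bar complex with trivial coefficients Z, in degrees 1, 2, 3:
   [freeg] is free abelian, and << (g, h) >> is the bar symbol [g|h]. *)
Definition bar1 := {freeg G / int}.
Definition bar2 := {freeg (G * G)%type / int}.
Definition bar3 := {freeg (G * G * G)%type / int}.

Definition bar_d2 : bar2 -> bar1 :=
  fglift (fun x : G * G =>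
    let: (g, h) := x in << h >> - << (g * h)%g >> + << g >> : bar1).

Definition bar_d3 : bar3 -> bar2 :=
  fglift (fun x : G * G * G =>
    let: (g, h, k) := x in
    << (h, k) >> - << ((g * h)%g, k) >> + << (g, (h * k)%g) >>
      - << (g, h) >> : bar2).

HB.instance Definition _ :=
  GRing.isZmodMorphism.Build bar2 bar1 bar_d2 (lift_is_additive _).
HB.instance Definition _ :=
  GRing.isZmodMorphism.Build bar3 bar2 bar_d3 (lift_is_additive _).

Lemma bar_d2U g h :
  bar_d2 << (g, h) >> = << h >> - << (g * h)%g >> + << g >>.
Proof. by rewrite /bar_d2 liftU scale1r. Qed.

Lemma bar_d3U g h k :
  bar_d3 << (g, h, k) >> =
    << (h, k) >> - << ((g * h)%g, k) >> + << (g, (h * k)%g) >> - << (g, h) >>.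
Proof. by rewrite /bar_d3 liftU scale1r. Qed.

Lemma bar_d2d3 (z : bar3) : bar_d2 (bar_d3 z) = 0.
Proof.
rewrite -[z]freeg_sumE !raddf_sum big1 // => -[[g h] k] _ /=.
set n := coeff _ _; rewrite -[n]intz -freegU_mulz !raddfMz. rewrite /= bar_d3U.
rewrite raddfB raddfD raddfB /= !bar_d2U mulgA !opprD !opprK !addrA.
rewrite [X in X *~ _](ACl
  ((1 * 4) * (2 * 7) * (3 * 10) * (5 * 8) * (6 * 11) * (9 * 12)))%AC /=.
by rewrite !(subrr, addNr, addr0) mul0rz.
Qed.

Definition cycle2_pred : {pred bar2} := [pred z | bar_d2 z == 0].

Fact cycle2_zmod_closed : zmod_closed cycle2_pred.
Proof.
split=> [|x y]; rewrite !inE ?raddf0 // => /eqP x0 /eqP y0.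
by rewrite raddfB /= x0 y0 subr0.
Qed.
HB.instance Definition _ :=
  GRing.isZmodClosed.Build bar2 cycle2_pred cycle2_zmod_closed.

Record cycle2 := Cycle2 { cycle2_val :> bar2; _ : cycle2_val \in cycle2_pred }.
HB.instance Definition _ := [isSub for cycle2_val].
HB.instance Definition _ := [Choice of cycle2 by <:].
HB.instance Definition _ := [SubChoice_isSubZmodule of cycle2 by <:].

Definition boundary2 : {pred cycle2} :=
  fun z => `[< exists y : bar3, bar_d3 y = cycle2_val z >].

Fact boundary2_zmod_closed : zmod_closed boundary2.
Proof.
split=> [|x y]; first by apply/asboolP; exists 0; rewrite raddf0.
move=> /asboolP[x' Ex] /asboolP[y' Ey]; apply/asboolP; exists (x' - y').
by rewrite raddfB /= Ex Ey.
Qed.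
HB.instance Definition _ :=
  GRing.isZmodClosed.Build cycle2 boundary2 boundary2_zmod_closed.

Definition H2 : zmodType := Quotient.quot boundary2.

End SecondHomology.

Definition torsion_free (M : zmodType) : Prop :=
  forall (x : M) (n : nat), (0 < n)%N -> (x *+ n = 0 -> x = 0)%R.

(* Main.v *)
Require Import Defs.
From HB Require Import structures.
From mathcomp Require Import all_boot all_order all_algebra.
From mathcomp Require Import zify monoid boolp classical_sets freeg.

(** Write T for the exterior square of G and d : T -> G for the map sending a
wedge g /\ h to the commutator of g and h.

Let p : K -> G be a central extension. The commutator of two elements of K
depends only on their images in G, so lifting g and h to K and taking the
commutator defines a homomorphism j : T -> K ([central_crossed]), with p \o j
= d. Its kernel lies in ker d, which is central in T. If ker d is
torsion-free, then ker j is a torsion-free abelian group and hence carries a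
translation-invariant total order ([positive_cone]); combining it
lexicographically with a left order or a circular order of K, pulled back
along j, gives an order of the same kind on T ([left_orderable_lex],
[circularly_orderable_lex]).

The main point is that ker d is torsion-free when H_2(G) is
([exterior_torsion_free]). By a theorem of Miller ker d is H_2(G); what the
argument needs is that an element t of ker d whose bar cycle is a boundary is
trivial, and that the cycle of t is torsion in homology if t is torsion in T.

The cycle comes from factor sets. Given homomorphisms p : K -> G and
j : T -> K related as above (the pair is then called [crossed]) and a set
section s of p, put F[g|h] = s(g) s(h) s(gh)^-1, extended additively to
2-chains with values in the centre of K. Then F kills boundaries. Expanding
t in wedges produces one 2-chain z, independent of K, with
j(t) = F(z) s(d(t)) ([wedge_factor_map]); for t in ker d, adding [1|1] turns z
into a cycle w with j(t) = F(w).

In one direction, apply this to the extension of G by 2-chains modulo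
boundaries whose factor set is tautological ([cocycle_extension]): if t^n = 1
then n w is a boundary, so w is a boundary d3(y), as H_2(G) is torsion-free.

In the other direction, one needs a crossed pair with j injective, for which
F(w) = F(d3(y)) = 1 then forces t = 1. Only finitely many elements of G occur
in z and y, so it is enough that s is a section over a finite subset S of G
([crossed_embedding]). Such a pair is built from (T, d, id), which is crossed
by the Peiffer identities ([peiffer], [wedge_boundary]), by adjoining the
elements of S one at a time: if (E, p, j) is crossed then G acts on E by
g . e = j(g /\ p(e)) e, and for x in G the semidirect product of E with the
integers, acting through the powers of x, is crossed again with x in the image
([crossed_adjoin]). Each step keeps j injective. *)

Set Implicit Arguments.
Unset Strict Implicit.
Unset Printing Implicit Defensive.

Import GRing.Theory.
Local Open Scope group_scope.

(** * Group morphisms *)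

(** Associativity restated over [groupType]: both sides then use one and the
same structure path on a concrete group such as an exterior square, and
rewriting stays syntactic. *)
Lemma group_mulA (K : groupType) (x y z : K) : x * (y * z) = x * y * z.
Proof. exact: mulgA. Qed.

(** * Maps out of presented groups and exterior squares *)

Section GroupMorphism.
Variables (G H : groupType) (f : {multiplicative G -> H}).

Lemma groupf1 : f 1 = 1.
Proof. by apply: (mulgI (f 1)); rewrite -gmulfM !mulg1. Qed.

Lemma groupfV : {morph f : x / x^-1}.
Proof. by move=> x; apply: (mulgI (f x)); rewrite -gmulfM !mulgV groupf1. Qed.

Lemma groupfX n : {morph f : x / x ^+ n}.
Proof.
by move=> x; elim: n => [|n IHn]; rewrite ?groupf1 // !expgS gmulfM IHn.
Qed.

End GroupMorphism.

Section PresentedMap.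
Variables (X : choiceType) (rels : word X -> word X -> Prop).
Variables (E : groupType) (f : X -> E).

Definition word_eval (w : word X) : E :=
  foldr (fun l e => (if l.1 then (f l.2)^-1 else f l.2) * e) 1 w.

Lemma word_eval_cat u v : word_eval (u ++ v) = word_eval u * word_eval v.
Proof. by elim: u => [|l u IHu] /=; rewrite ?mul1g // IHu mulgA. Qed.

Lemma presented_lift :
    (forall u v, rels u v -> word_eval u = word_eval v) ->
  exists phi : {multiplicative presented rels -> E},
    forall x, phi (pres_gen rels x) = f x.
Proof.
move=> f_rels; pose phi (x : presented rels) := word_eval (repr x).
have evalP u v : pres_cong rels u v -> word_eval u = word_eval v.
  elim=> {u v} [//|u v _ -> //|u v w _ -> _ //|u u' v v' _ Eu _ Ev||//].
  - by rewrite !word_eval_cat Eu Ev.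
  - by move=> [] x /=; rewrite mulg1 (mulgV, mulVg).
have phi_pi u : phi (pres_class rels u) = word_eval u.
  exact/evalP/pres_repr.
have phiM : {morph phi : x y / x * y}.
  move=> x y; rewrite -[x]pres_classK -[y]pres_classK.
  by rewrite [_ * _]pres_piM !phi_pi word_eval_cat.
pose phi_hom := isMultiplicative.Build _ _ phi phiM.
pose Phi : {multiplicative presented rels -> E} := HB.pack phi phi_hom.
by exists Phi => x; rewrite /Phi /= phi_pi /= mulg1.
Qed.

End PresentedMap.

Lemma nquo_lift (G E : groupType) (S : G -> Prop)
    (f : {multiplicative G -> E}) :
    (forall s, S s -> f s = 1) ->
  exists phi : {multiplicative nquo S -> E},
    forall x, phi (nquo_class S x) = f x.
Proof.
move=> fS; pose phi (x : nquo S) := f (repr x).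
have kerN : normal_subgroup (fun x => f x = 1).
  split=> [|x y fx fy|x fx|x g fx].
  - exact: groupf1.
  - by rewrite gmulfM fx fy mulg1.
  - by rewrite groupfV fx invg1.
  - by rewrite !gmulfM fx mulg1 groupfV mulgV.
have phi_pi x : phi (nquo_class S x) = f x.
  have /(_ _ kerN fS)/eqP := @nquo_repr G S x.
  by rewrite gmulfM groupfV divg_eq1 => /eqP.
have phiM : {morph phi : x y / x * y}.
  move=> x y; rewrite -[x]nquo_classK -[y]nquo_classK.
  by rewrite [_ * _]nquo_piM !phi_pi gmulfM.
pose phi_hom := isMultiplicative.Build _ _ phi phiM.
pose Phi : {multiplicative nquo S -> E} := HB.pack phi phi_hom.
by exists Phi.
Qed.

Section Exterior.
Variable G : groupType.
Implicit Types g h k : G.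

Local Notation T := (exterior_square G).

Definition wedge g h : T := nquo_class _ (tensor g h).

Lemma tensorMl g h k :
  tensor (g * h) k = tensor (lconjg g h) (lconjg g k) * tensor g k.
Proof.
rewrite /tensor /pres_gen [RHS]pres_piM.
by apply/presentedP/pres_rels/tensor_relMl.
Qed.

Lemma tensorMr g h k :
  tensor g (h * k) = tensor g h * tensor (lconjg h g) (lconjg h k).
Proof.
rewrite /tensor /pres_gen [RHS]pres_piM.
by apply/presentedP/pres_rels/tensor_relMr.
Qed.

Lemma wedgeMl g h k :
  wedge (g * h) k = wedge (lconjg g h) (lconjg g k) * wedge g k.
Proof. by rewrite /wedge tensorMl [RHS]nquo_piM. Qed.

Lemma wedgeMr g h k :
  wedge g (h * k) = wedge g h * wedge (lconjg h g) (lconjg h k).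
Proof. by rewrite /wedge tensorMr [RHS]nquo_piM. Qed.

Lemma wedgexx g : wedge g g = 1.
Proof.
apply/nquoP; rewrite invg1 mulg1 => N _; apply; by exists g.
Qed.

Lemma exterior_lift (E : groupType) (f : G -> G -> E) :
    (forall g h k, f (g * h) k = f (lconjg g h) (lconjg g k) * f g k) ->
    (forall g h k, f g (h * k) = f g h * f (lconjg h g) (lconjg h k)) ->
    (forall g, f g g = 1) ->
  exists phi : {multiplicative T -> E}, forall g h, phi (wedge g h) = f g h.
Proof.
move=> fMl fMr fxx.
have [u v []|phi phiE] :=
  @presented_lift _ (@tensor_rels G) E (fun x => f x.1 x.2).
- by move=> g h k /=; rewrite !mulg1.
- by move=> g h k /=; rewrite !mulg1.
have [_ [g ->]|psi psiE] :=
  @nquo_lift _ _ (fun t => exists g : G, t = tensor g g) phi.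
  by rewrite phiE.
by exists psi => g h; rewrite psiE phiE.
Qed.

Lemma lconjgM g h k : lconjg (g * h) k = lconjg g (lconjg h k).
Proof. by rewrite /lconjg invgM !mulgA. Qed.

Lemma lconjgxx g : lconjg g g = g.
Proof. exact: mulgK. Qed.

Lemma lconjMg g h k : lconjg g (h * k) = lconjg g h * lconjg g k.
Proof. by rewrite /lconjg !mulgA mulgVK. Qed.

Lemma lconjgKV g : cancel (lconjg g^-1) (lconjg g).
Proof. by move=> h; rewrite -lconjgM mulgV /lconjg mul1g divg1. Qed.

(** Conjugating by g, one may write h = ^g k; then (gk) /\ (gk) = 1 expands by
both relations to the product below, the diagonal wedges being trivial. *)
Lemma wedgeC g h : wedge h g * wedge g h = 1.
Proof.
rewrite -[h](lconjgKV g); move: (lconjg _ h) => k.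
have := wedgexx (g * k); rewrite wedgeMl !lconjMg lconjgxx wedgeMr.
by rewrite wedgexx mulg1 wedgeMr wedgexx mul1g lconjgxx.
Qed.

Lemma wedge1l h : wedge 1 h = 1.
Proof.
apply: (mulgI (wedge 1 h)); rewrite mulg1 -{3}[1]mulg1 wedgeMl.
by rewrite /lconjg !(mul1g, divg1).
Qed.

Lemma wedge1r h : wedge h 1 = 1.
Proof. by have := wedgeC 1 h; rewrite wedge1l mulg1. Qed.

Lemma wedgeV g h : (wedge g h)^-1 = wedge h g.
Proof. exact/mulg1_eq/wedgeC. Qed.

(** Closure under inverses comes for free, the inverse of g /\ h being
h /\ g. *)
Lemma exterior_ind (P : T -> Prop) :
    P 1 -> (forall g h, P (wedge g h)) ->
    (forall t u, P t -> P u -> P (t * u)) ->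
  forall t, P t.
Proof.
move=> P1 Pw PM t; rewrite -[t]nquo_classK -[repr t]pres_classK.
elim: (repr _) => [|[b [g h]] w IHw]; first exact: P1.
rewrite -cat1s -pres_piM -[nquo_class _ _]nquo_piM; apply: PM => //.
case: b; last exact: Pw.
rewrite -[pres_class _ _]/(pres_class _ (word_inv [:: (false, (g, h))])).
by rewrite -pres_piV -nquo_piV [nquo_inv _]wedgeV.
Qed.

Lemma exterior_hom_eq (E : groupType) (f f' : {multiplicative T -> E}) :
  (forall g h, f (wedge g h) = f' (wedge g h)) -> f =1 f'.
Proof.
move=> ff'; apply: exterior_ind => [|//|t u ft fu].
  by rewrite !groupf1.
by rewrite !gmulfM ft fu.
Qed.

End Exterior.

(** * Central extensions *)

(** The relation between p and j says that the commutator of x and y in K is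
the image of the wedge of their projections. It makes ker p central, and it
makes sense without surjectivity of p, which is what lets K be built up
gradually. *)
Definition crossed (G K : groupType) (p : K -> G)
    (j : exterior_square G -> K) :=
  forall x y, x * y = j (wedge (p x) (p y)) * y * x.

(** The commutator in the convention of left conjugation, as opposed to
[~ x, y]. *)
Definition comm_left (K : groupType) (x y : K) := x * y * x^-1 * y^-1.

(** Commutators in K are unchanged when their entries are multiplied by
central elements, so they descend to G; the defining relations of the exterior
square are then the usual commutator identities. *)
Lemma central_crossed (G K : groupType) (p : {multiplicative K -> G}) :
    (forall g, exists k, p k = g) ->
    (forall z k, p z = 1 -> commute z k) ->
  exists j : {multiplicative exterior_square G -> K}, crossed p j.
Proof.
move=> /choice[s ps] kerC.
have c_indep x y x' y' : p x = p x' -> p y = p y' ->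
    comm_left x y = comm_left x' y'.
  have kerE u v : p u = p v -> exists2 a, u = a * v & forall k, commute a k.
    move=> uv; exists (u / v); first by rewrite mulgVK.
    by move=> k; apply: kerC; rewrite gmulfM groupfV uv mulgV.
  move=> /kerE[a -> aC] /kerE[b -> bC]; rewrite /comm_left !invgM !mulgA.
  have := aC (x' * (b * y') / x'); rewrite /commute !mulgA => ->.
  rewrite mulgK -bC.
  have := bC (x' * y' / x' / y'); rewrite /commute !mulgA => ->.
  by rewrite mulgK.
pose f g h := comm_left (s g) (s h).
(* From here on elements of G may be lifted to K at will, not only through s. *)
have fE x y : f (p x) (p y) = comm_left x y by apply: c_indep; rewrite ps.
have pJ x y : lconjg (p x) (p y) = p (lconjg x y).
  by rewrite /lconjg !gmulfM groupfV.
have [g h k|g h k|g|j jE] := @exterior_lift G K f.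
- rewrite -[g]ps -[h]ps -[k]ps !pJ -gmulfM !fE /comm_left /lconjg.
  by rewrite !(invgM, invgK, mulgA, mulgVK).
- rewrite -[g]ps -[h]ps -[k]ps !pJ -gmulfM !fE /comm_left /lconjg.
  by rewrite !(invgM, invgK, mulgA, mulgVK).
- by rewrite /f /comm_left mulgK mulgV.
by exists j => x y; rewrite jE fE /comm_left !mulgVK.
Qed.

(** * The exterior square as a crossed module *)

Section CrossedModule.
Variable G : groupType.
Implicit Types g h k : G.

Local Notation T := (exterior_square G).
Implicit Types t u : T.

Lemma ext_boundary_exists :
  exists d : {multiplicative T -> G}, crossed (@idfun G) d.
Proof.
apply: (@central_crossed G G idfun) => [g|z k /= ->]; first by exists g.
by rewrite /commute mul1g mulg1.
Qed.

Definition ext_boundary := projT1 (cid ext_boundary_exists).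
Local Notation d := ext_boundary.

Lemma ext_boundaryP g h : g * h = d (wedge g h) * h * g.
Proof. exact: (projT2 (cid ext_boundary_exists)). Qed.

Lemma ext_boundary_lconjg g h : d (wedge g h) * h = lconjg g h.
Proof. by rewrite /lconjg (ext_boundaryP g h) mulgK. Qed.

Lemma lconjgJ g h k : lconjg g (lconjg h k) = lconjg (lconjg g h) (lconjg g k).
Proof. by rewrite -!lconjgM /lconjg mulgVK. Qed.

Lemma ext_act_exists g : exists f : {multiplicative T -> T},
  forall h k, f (wedge h k) = wedge (lconjg g h) (lconjg g k).
Proof.
apply: exterior_lift => [h k l|h k l|h].
- by rewrite lconjMg wedgeMl -!lconjgJ.
- by rewrite lconjMg wedgeMr -!lconjgJ.
- exact: wedgexx.
Qed.

Definition ext_act g := projT1 (cid (ext_act_exists g)).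

Lemma ext_actE g h k :
  ext_act g (wedge h k) = wedge (lconjg g h) (lconjg g k).
Proof. exact: (projT2 (cid (ext_act_exists g))). Qed.

Lemma ext_actM g h t : ext_act (g * h) t = ext_act g (ext_act h t).
Proof.
apply: (@exterior_hom_eq _ _ _ (ext_act g \o ext_act h)) => k l /=.
by rewrite !ext_actE !lconjgM.
Qed.

Lemma ext_act1 t : ext_act 1 t = t.
Proof.
apply: (@exterior_hom_eq _ _ _ idfun) => k l /=.
by rewrite ext_actE /lconjg !mul1g !divg1.
Qed.

Lemma wedgeMl_act g h k : wedge (g * h) k = ext_act g (wedge h k) * wedge g k.
Proof. by rewrite ext_actE wedgeMl. Qed.

Lemma wedgeMr_act g h k : wedge g (h * k) = wedge g h * ext_act h (wedge g k).
Proof. by rewrite ext_actE wedgeMr. Qed.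

(** Expand the left entry as gh = h (h^-1 g h). *)
Lemma wedge_conjr g h k : wedge g (lconjg h k) * wedge h k = wedge (g * h) k.
Proof.
have -> : g * h = h * lconjg h^-1 g.
  by rewrite /lconjg invgK !group_mulA mulgV mul1g.
by rewrite wedgeMl lconjgKV.
Qed.

(** Expanding gg' /\ hh' first on the left and then on the right, or the other
way round, gives products that differ in the two middle factors only. *)
Lemma peiffer_wedge g h g' h' :
  wedge g h * ext_act (h * g) (wedge g' h') =
    ext_act (g * h) (wedge g' h') * wedge g h.
Proof.
have E1 := wedgeMl_act g g' (h * h').
have E2 := wedgeMr_act (g * g') h h'.
rewrite E1 !wedgeMr_act !gmulfM -!ext_actM !group_mulA in E2.
rewrite !wedgeMl_act !gmulfM -!ext_actM !group_mulA in E2.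
move: E2 => /mulIg; rewrite -!group_mulA => /mulgI.
by move=> ->.
Qed.

(** Conjugation by t in T is the action of d(t); in particular ker d is
central. *)
Lemma peiffer t u : t * u = ext_act (d t) u * t.
Proof.
move: u; elim/exterior_ind: t => [u|g h u|t t' IHt IHt' u].
- by rewrite groupf1 ext_act1 mul1g mulg1.
- elim/exterior_ind: u => [|g' h'|u u' IHu IHu'].
  + by rewrite groupf1 mul1g mulg1.
  + have := peiffer_wedge g h (lconjg (h * g)^-1 g') (lconjg (h * g)^-1 h').
    rewrite !ext_actE !lconjgKV => ->; congr (_ * _).
    rewrite -!ext_actE -ext_actM; congr (ext_act _ _).
    by rewrite (ext_boundaryP g h) -[d _ * h * g]group_mulA mulgK.
  + by rewrite gmulfM group_mulA IHu -!group_mulA IHu'.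
- by rewrite -group_mulA IHt' group_mulA IHt -group_mulA gmulfM ext_actM.
Qed.

(** Both sides are multiplicative in t, by [peiffer], so it suffices to take
t = h /\ k; there [h, k] k = h k h^-1, and both sides multiplied by g /\ k are
equal to gh /\ k by [wedge_conjr]. *)
Lemma wedge_boundary g t : wedge g (d t) * t = ext_act g t.
Proof.
elim/exterior_ind: t => [|h k|t u IHt IHu].
- by rewrite !groupf1 wedge1r mulg1.
- apply: (mulIg (wedge g k)); rewrite -wedgeMl_act -wedge_conjr.
  by rewrite -ext_boundary_lconjg wedgeMr_act -!group_mulA -peiffer.
- rewrite !gmulfM wedgeMr_act -!group_mulA [_ * (t * u)]group_mulA -peiffer.
  by rewrite -IHt -IHu !group_mulA.
Qed.

Lemma crossed_ext_boundary : crossed d (@idfun T).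
Proof. by move=> t u /=; rewrite wedge_boundary peiffer. Qed.

End CrossedModule.

(** * Adjoining elements to a crossed extension *)

Section IntegerPower.
Variable G : groupType.
Implicit Types g h : G.

(** Powers with exponents in the additive group of integers, which is the
group adjoined below. *)
Definition zexpg g (n : int) : G :=
  match n with Posz m => g ^+ m | Negz m => g ^- m.+1 end.

Lemma zexpgS g (n : int) : zexpg g (n + 1)%R = zexpg g n * g.
Proof.
case: n => [n|[|n]] /=; first by rewrite addn1 expgSr.
  by rewrite mulVg.
by rewrite subn1 (expgS g n.+1) invgM mulgVK.
Qed.

Lemma zexpgD g (m n : int) : zexpg g (m + n)%R = zexpg g m * zexpg g n.
Proof.
elim/int_rect: n => [|n IHn|n IHn]; first by rewrite addr0 mulg1.
  by rewrite intS [(1 + _)%R]addrC addrA !zexpgS IHn mulgA.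
have nE : (- n.+1%:Z + 1 = - n%:Z)%R by rewrite intS opprD addrAC addNr add0r.
by apply: (mulIg g); rewrite -mulgA -!zexpgS -addrA nE IHn.
Qed.

Lemma wedge_zexpgl g h (n : int) : wedge g h = 1 -> wedge (zexpg g n) h = 1.
Proof.
move=> gh; have wS (m : int) : wedge (zexpg g (m + 1)) h = wedge (zexpg g m) h.
  by rewrite zexpgS wedgeMl_act gh groupf1 mul1g.
elim/int_rect: n => [|n IHn|n IHn]; first exact: wedge1l.
  by rewrite intS addrC wS.
by rewrite -wS intS opprD addrAC addNr add0r.
Qed.

Lemma wedge_zexpg g (m n : int) : wedge (zexpg g m) (zexpg g n) = 1.
Proof.
apply: wedge_zexpgl; apply: invg_inj; rewrite wedgeV invg1.
exact/wedge_zexpgl/wedgexx.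
Qed.

End IntegerPower.

(** The identity in T that makes the semidirect product crossed: a and b stand
for powers of the adjoined element. *)
Lemma wedge_swap (G : groupType) (a b g h : G) : wedge a b = 1 ->
  wedge (g * a) (h * b) * ext_act h (wedge b g) =
    ext_act g (wedge a h) * wedge g h.
Proof.
move=> ab; rewrite wedgeMl_act !wedgeMr_act ab groupf1 mulg1 -!group_mulA.
by rewrite -gmulfM wedgeC groupf1 mulg1.
Qed.

Section Crossed.
Variables (G E : groupType) (p : {multiplicative E -> G}).
Variable j : {multiplicative exterior_square G -> E}.
Hypothesis pj : crossed p j.

Lemma crossed_ker_central z : p z = 1 -> forall e, commute z e.
Proof. by move=> pz e; rewrite /commute pj pz wedge1l groupf1 mul1g. Qed.

(** In a crossed pair whose p hits g, this is conjugation by a preimage of g;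
the formula gives an action of all of G. *)
Definition crossed_act g e : E := j (wedge g (p e)) * e.

Hypothesis p_j : forall t, p (j t) = ext_boundary G t.

(** Here [wedge_boundary] turns the commutator of e and j(t) into the action of
p(e) on t. *)
Lemma crossed_conj e t : e * j t = j (ext_act (p e) t) * e.
Proof. by rewrite pj p_j -gmulfM wedge_boundary. Qed.

Lemma crossed_actE g e : p (crossed_act g e) = lconjg g (p e).
Proof. by rewrite gmulfM p_j ext_boundary_lconjg. Qed.

Lemma crossed_actMl g h e :
  crossed_act (g * h) e = crossed_act g (crossed_act h e).
Proof.
rewrite {2}/crossed_act crossed_actE /crossed_act group_mulA -gmulfM.
by rewrite wedge_conjr.
Qed.

Lemma crossed_actMr g e f :
  crossed_act g (e * f) = crossed_act g e * crossed_act g f.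
Proof.
rewrite /crossed_act gmulfM wedgeMr_act gmulfM -!group_mulA; congr (_ * _).
by rewrite group_mulA -crossed_conj -group_mulA.
Qed.

Lemma crossed_act1l e : crossed_act 1 e = e.
Proof. by rewrite /crossed_act wedge1l groupf1 mul1g. Qed.

Lemma crossed_act1r g : crossed_act g 1 = 1.
Proof. by rewrite /crossed_act groupf1 wedge1r groupf1 mul1g. Qed.

Variable x : G.

(** The semidirect product of E with the integers, the generator acting as x.
It is infinite over E even if a power of x already lies in the image of p: the
projection to G then gets a larger kernel, which is still central. *)
Definition zext_mul (a b : E * int) : E * int :=
  (a.1 * crossed_act (zexpg x a.2) b.1, (a.2 + b.2)%R).
Definition zext_one : E * int := (1, 0%R).
Definition zext_inv (a : E * int) : E * int :=
  (crossed_act (zexpg x (- a.2)) a.1^-1, (- a.2)%R).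

Fact zext_mulA : associative zext_mul.
Proof.
move=> a b c; rewrite /zext_mul /=; congr pair; last exact: addrA.
by rewrite crossed_actMr zexpgD crossed_actMl group_mulA.
Qed.

Fact zext_mul1 : left_id zext_one zext_mul.
Proof. by move=> [e k]; rewrite /zext_mul /= crossed_act1l mul1g add0r. Qed.

Fact zext_mulr1 : right_id zext_one zext_mul.
Proof. by move=> [e k]; rewrite /zext_mul /= crossed_act1r mulg1 addr0. Qed.

Fact zext_mulV : left_inverse zext_one zext_inv zext_mul.
Proof.
move=> [e k]; rewrite /zext_mul /= -crossed_actMr mulVg crossed_act1r.
by rewrite addNr.
Qed.

Fact zext_mulrV : right_inverse zext_one zext_inv zext_mul.
Proof.
move=> [e k]; rewrite /zext_mul /= -crossed_actMl -zexpgD subrr.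
by rewrite crossed_act1l mulgV.
Qed.

(** Crossedness comes down to [wedge_swap], as powers of x have trivial wedges
with one another. *)
Lemma crossed_adjoin :
  exists (E' : groupType) (p' : {multiplicative E' -> G})
      (j' : {multiplicative exterior_square G -> E'}),
    [/\ crossed p' j', forall t, p' (j' t) = ext_boundary G t,
        injective j -> injective j', exists e, p' e = x &
        forall e, exists e', p' e' = p e].
Proof.
pose E'_isGroup := isGroup.Build (E * int)%type
  zext_mulA zext_mul1 zext_mulr1 zext_mulV zext_mulrV.
pose E' : groupType := HB.pack (E * int)%type E'_isGroup.
pose p'_fun (a : E') : G := p a.1 * zexpg x a.2.
have p'M : {morph p'_fun : a b / a * b}.
  move=> a b; rewrite /p'_fun /= gmulfM crossed_actE /lconjg zexpgD !group_mulA.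
  by rewrite mulgVK.
pose p'_hom := isMultiplicative.Build _ _ p'_fun p'M.
pose p' : {multiplicative E' -> G} := HB.pack p'_fun p'_hom.
pose j'_fun t : E' := (j t, 0%R).
have j'M : {morph j'_fun : t u / t * u}.
  move=> t u; rewrite /j'_fun gmulfM.
  by rewrite /mul /= /zext_mul /= crossed_act1l addr0.
pose j'_hom := isMultiplicative.Build _ _ j'_fun j'M.
pose j' : {multiplicative exterior_square G -> E'} := HB.pack j'_fun j'_hom.
exists E', p', j'; split=> [[e k] [f l]|t|j_inj t u [/j_inj //]||e].
- rewrite /mul /= /zext_mul /p'_fun /= crossed_act1l !add0r addrC; congr pair.
  rewrite /crossed_act group_mulA crossed_conj -group_mulA (pj e f).
  rewrite -!group_mulA [LHS]group_mulA -gmulfM.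
  rewrite -(@wedge_swap _ _ (zexpg x l)) ?wedge_zexpg //.
  rewrite gmulfM -group_mulA; congr (_ * _).
  by rewrite group_mulA -crossed_conj -group_mulA.
- by rewrite /= /p'_fun /= p_j mulg1.
- by exists (1, 1%R); rewrite /= /p'_fun /= groupf1 mul1g.
- by exists (e, 0%R); rewrite /= /p'_fun /= mulg1.
Qed.

End Crossed.

(** Start from T itself, which is crossed over G by [peiffer] and
[wedge_boundary]. *)
Lemma crossed_embedding (G : groupType) (S : seq G) :
  exists (E : groupType) (p : {multiplicative E -> G})
      (j : {multiplicative exterior_square G -> E}),
    [/\ crossed p j, injective j & forall g, g \in S -> exists e, p e = g].
Proof.
suff [E [p [j [pj _ j_inj pS]]]] : exists (E : groupType)
    (p : {multiplicative E -> G}) (j : {multiplicative exterior_square G -> E}),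
    [/\ crossed p j, forall t, p (j t) = ext_boundary G t, injective j &
        forall g, g \in S -> exists e, p e = g].
  by exists E, p, j.
elim: S => [|x S [E [p [j [pj p_j j_inj pS]]]]].
  exists (exterior_square G), (ext_boundary G), idfun.
  by split=> //; exact: crossed_ext_boundary.
have [E' [p' [j' [pj' p_j' j'_inj p'x p'p]]]] := crossed_adjoin pj p_j x.
exists E', p', j'; split=> // [|g]; first exact: j'_inj.
by rewrite inE => /orP[/eqP-> //|/pS[e <-]]; exact: p'p.
Qed.

(** * Factor sets and chains *)

Section Center.
Variable K : groupType.

Definition central : {pred K} := fun z => `[< forall k, commute z k >].

(** The centre of K written additively, so that it can receive additive maps
from free abelian groups. *)
Record center := Center { center_val : K; _ : center_val \in central }.
HB.instance Definition _ := [isSub for center_val].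
HB.instance Definition _ := [Choice of center by <:].

Lemma centerC (z : center) k : commute (center_val z) k.
Proof. by case: z => z /= /asboolP. Qed.

Fact center1 : 1 \in central.
Proof. by apply/asboolP => k; exact/commute_sym/commute1. Qed.
Fact centerM (y z : center) : center_val y * center_val z \in central.
Proof.
by apply/asboolP => k; apply/commute_sym/commuteM; apply/commute_sym/centerC.
Qed.
Fact centerV (z : center) : (center_val z)^-1 \in central.
Proof.
by apply/asboolP => k; apply/commute_sym/commuteV/commute_sym/centerC.
Qed.

Definition center_add y z := Center (centerM y z).

Fact center_addA : associative center_add.
Proof. by move=> x y z; apply: val_inj; exact: mulgA. Qed.
Fact center_addC : commutative center_add.
Proof. by move=> x y; apply: val_inj; exact: centerC. Qed.
Fact center_add0 : left_id (Center center1) center_add.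
Proof. by move=> x; apply: val_inj; exact: mul1g. Qed.
Fact center_addN :
  left_inverse (Center center1) (fun z => Center (centerV z)) center_add.
Proof. by move=> x; apply: val_inj; exact: mulVg. Qed.

HB.instance Definition _ := GRing.isZmodule.Build center
  center_addA center_addC center_add0 center_addN.

End Center.

Lemma freeg_lift (X : choiceType) (M : zmodType) (f : X -> M) :
  exists F : {freeg X / int} -> M,
    {morph F : x y / (x + y)%R} /\ forall x, F << x >> = f x.
Proof.
exists (fglift (f : X -> zmodule M)); split=> [x y|x].
  pose F := GRing.isZmodMorphism.Build _ _ (fglift (f : X -> zmodule M))
    (lift_is_additive _).
  pose F' : {additive {freeg X / int} -> zmodule M} :=
    HB.pack (fglift (f : X -> zmodule M)) F.
  exact: (raddfD F').
by rewrite liftU scale1r.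
Qed.

Section Cochain.
Variable G : groupType.
Local Notation bar g h := (<< (g%g, h%g) >> : bar2 G).
Implicit Types g h k : G.

(** A section over part of G only: the crossed pairs with injective j are
constructed so as to cover a given finite set. *)
Definition section_on (S : seq G) (K : groupType) (p : K -> G) (s : G -> K) :=
  {in S, forall g, p (s g) = g}.

(** The factor set of s, extended additively from bar symbols to 2-chains. It
is constrained only at symbols whose three entries are lifted by s. *)
Definition factor_map (K : groupType) (p : K -> G) (s : G -> K)
    (F : bar2 G -> K) :=
  [/\ {morph F : y z / (y + z)%R >-> y * z}, forall z (k : K), commute (F z) k &
      forall g h, section_on [:: g; h; g * h] p s ->
        s g * s h = F (bar g h) * s (g * h)].

(** Where s is a section, s(g) s(h) s(gh)^-1 lies over 1 and is therefore
central; at the remaining symbols [insubd] supplies the neutral element. *)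
Lemma factor_map_exists (K : groupType) (p : {multiplicative K -> G})
    (j : {multiplicative exterior_square G -> K}) (s : G -> K) :
  crossed p j -> exists F, factor_map p s F.
Proof.
move=> pj; pose c g h := s g * s h * (s (g * h))^-1.
have [F [FD FE]] := freeg_lift (fun x : G * G =>
  insubd (0%R : center K) (c x.1 x.2)).
exists (fun z => val (F z)); split=> [y z|z k|g h sS].
- by rewrite FD.
- exact: centerC.
rewrite FE /= insubdK ?mulgVK // /c.
apply/asboolP; apply: (crossed_ker_central pj).
by rewrite !gmulfM groupfV !sS ?inE ?eqxx ?orbT ?mulgV.
Qed.

Section FactorMap.
Variables (K : groupType) (p : K -> G) (s : G -> K) (F : bar2 G -> K).
Hypothesis sF : factor_map p s F.

Lemma factor_mapD y z : F (y + z)%R = F y * F z. Proof. by case: sF. Qed.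

Lemma factor_mapC z (k : K) : F z * k = k * F z.
Proof. by case: sF => _ FC _; exact: FC. Qed.

Lemma factor_map0 : F 0%R = 1.
Proof. by apply: (mulgI (F 0%R)); rewrite -factor_mapD addr0 mulg1. Qed.

Lemma factor_mapN z : F (- z)%R = (F z)^-1.
Proof. by apply/esym/mulg1_eq; rewrite -factor_mapD subrr factor_map0. Qed.

Lemma factor_mapE g h : section_on [:: g; h; g * h] p s ->
  s g * s h = F (bar g h) * s (g * h).
Proof. by case: sF => _ _; exact. Qed.

Lemma factor_map_section1 : section_on [:: 1] p s -> s 1 = F (bar 1 1).
Proof.
move=> s1; apply: (mulIg (s 1)); rewrite factor_mapE ?mulg1 // => g.
by rewrite !inE !orbb => /eqP->; apply: s1; rewrite inE.
Qed.

(** The cocycle identity: compare the two bracketings of s(g) s(h) s(k). *)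
Lemma factor_map_d3 g h k :
    section_on [:: g; h; k; g * h; h * k; g * h * k] p s ->
  F (bar_d3 << (g, h, k) >>) = 1.
Proof.
move=> sS; rewrite bar_d3U.
have sub S' : {subset S' <= [:: g; h; k; g * h; h * k; g * h * k]} ->
  section_on S' p s by move=> sub x /sub/sS.
have E1 : s g * s h * s k =
    F (bar g h + bar (g * h) k)%R * s (g * h * k).
  rewrite factor_mapE; last first.
    by apply: sub => x; rewrite !inE => /or3P[] ->; rewrite ?orbT.
  rewrite -group_mulA factor_mapE ?group_mulA ?factor_mapD //.
  by apply: sub => x; rewrite !inE => /or3P[] ->; rewrite ?orbT.
have E2 : s g * s h * s k =
    F (bar h k + bar g (h * k))%R * s (g * h * k).
  rewrite -group_mulA (@factor_mapE h k); last first.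
    by apply: sub => x; rewrite !inE => /or3P[] ->; rewrite ?orbT.
  rewrite group_mulA -factor_mapC -group_mulA.
  rewrite factor_mapE ?group_mulA ?factor_mapD //.
  by apply: sub => x; rewrite !inE => /or3P[] ->; rewrite ?orbT.
have -> : (bar h k - bar (g * h) k + bar g (h * k) - bar g h =
    (bar h k + bar g (h * k)) - (bar g h + bar (g * h) k)
    :> bar2 G)%R.
  by rewrite opprD addrA [RHS](ACl (1 * 4 * 2 * 3)).
move: E1; rewrite E2 => /mulIg E.
by rewrite factor_mapD factor_mapN E mulgV.
Qed.

End FactorMap.

(** A 3-chain involves finitely many elements of G, so sections over a suitable
finite set already satisfy all the cocycle identities that it requires. *)
Lemma factor_map_boundary (y : bar3 G) :
  exists S : seq G, forall (K : groupType) (p : K -> G) s F,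
    factor_map p s F -> section_on S p s -> F (bar_d3 y) = 1.
Proof.
elim/freeg_ind_dom0: y => [|n [[g h] k] y _ _ [S IHS]].
  by exists [::] => K p s F sF _; rewrite raddf0 (factor_map0 sF).
exists ([:: g; h; k; g * h; h * k; g * h * k] ++ S) => K p s F sF sS.
rewrite raddfD (factor_mapD sF) (IHS K p s) ?mulg1 //; last first.
  by move=> x xS; apply: sS; rewrite mem_cat xS orbT.
have F1 : F (bar_d3 << (g, h, k) >>) = 1.
  by apply: (factor_map_d3 sF) => x xS; apply: sS; rewrite mem_cat xS.
have FX m : F (bar_d3 << (g, h, k) >> *+ m)%R = 1.
  elim: m => [|m IHm]; first by rewrite mulr0n (factor_map0 sF).
  by rewrite mulrS (factor_mapD sF) F1 IHm mulg1.
rewrite -[n]intz -freegU_mulz raddfMz; case: n => n; first exact: FX.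
by rewrite NegzE mulrNz (factor_mapN sF) FX invg1.
Qed.

(** The 2-chain z and the finite set S depend on t alone, so that the same z
can be evaluated in several groups. The value of d2(z) shows that z + [1|1] is
a cycle when d(t) = 1. *)
Lemma wedge_factor_map (t : exterior_square G) :
  exists (z : bar2 G) (S : seq G), bar_d2 z = (- << ext_boundary G t >>)%R /\
    forall (K : groupType) (p : {multiplicative K -> G})
        (j : {multiplicative exterior_square G -> K}) s F,
      crossed p j -> factor_map p s F -> section_on S p s ->
    j t = F z * s (ext_boundary G t).
Proof.
elim/exterior_ind: t => [|g h|t u [z [S [dz tz]]] [z' [S' [dz' uz']]]].
- exists (- bar 1 1)%R, [:: 1]; split.
    by rewrite raddfN /= bar_d2U groupf1 mulg1 subrr add0r.
  move=> K p j s F pj sF s1.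
  by rewrite !groupf1 (factor_mapN sF) (factor_map_section1 sF s1) mulVg.
- set d := ext_boundary G (wedge g h).
  (* From s(d) s(hg) = F[d|hg] s(gh), with d the commutator of g and h. *)
  exists (bar g h - bar h g - bar d (h * g))%R.
  exists [:: g; h; g * h; h * g; d]; split.
    rewrite !raddfB /= !bar_d2U group_mulA -(ext_boundaryP g h).
    rewrite !opprD !opprK !addrA [LHS](ACl ((1*6) * (2*8) * (3*4) * (5*7) * 9)).
    by rewrite /= !(subrr, addNr) !add0r.
  move=> K p j s F pj sF sS.
  have sub S' : {subset S' <= [:: g; h; g * h; h * g; d]} ->
    section_on S' p s by move=> sub x /sub/sS.
  apply: (mulIg (s h * s g)).
  have := pj (s g) (s h); rewrite !sS ?inE ?eqxx ?orbT // -group_mulA => <-.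
  rewrite (@factor_mapE _ _ _ _ sF h g); last first.
    by apply: sub => x; rewrite !inE => /or3P[] ->; rewrite ?orbT.
  rewrite !(factor_mapD sF) !(factor_mapN sF).
  rewrite group_mulA -(factor_mapC sF) -!group_mulA.
  rewrite (@factor_mapE _ _ _ _ sF d (h * g)); last first.
    apply: sub => x; rewrite !inE group_mulA -(ext_boundaryP g h).
    by move=> /or3P[] ->; rewrite ?orbT.
  rewrite (@factor_mapE _ _ _ _ sF g h); last first.
    by apply: sub => x; rewrite !inE => /or3P[] ->; rewrite ?orbT.
  rewrite [d * _]group_mulA -(ext_boundaryP g h).
  rewrite mulKg group_mulA (factor_mapC sF _ (F (bar g h))).
  by rewrite -group_mulA mulVKg.
exists (z + z' + bar (ext_boundary G t) (ext_boundary G u))%R.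
exists ([:: ext_boundary G t; ext_boundary G u; ext_boundary G (t * u)] ++
  S ++ S').
split.
  rewrite !raddfD /= dz dz' bar_d2U gmulfM.
  by rewrite !addrA [LHS](ACl ((1*5) * (2*3) * 4)) /= !addNr !add0r.
move=> K p j s F pj sF sS.
rewrite !gmulfM (tz K p j s F) // ?(uz' K p j s F) //.
- rewrite !(factor_mapD sF) -!group_mulA -(factor_mapE sF).
    by congr (_ * _); rewrite group_mulA -(factor_mapC sF) group_mulA.
  by rewrite -gmulfM => x xS; apply: sS; rewrite mem_cat xS.
- by move=> x xS; apply: sS; rewrite !mem_cat xS !orbT.
- by move=> x xS; apply: sS; rewrite !mem_cat xS !orbT.
Qed.

End Cochain.

(** * The universal cocycle and torsion *)

Section CocycleExtension.
Variables (G : groupType) (B : zmodType) (c : G -> G -> B).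
Hypothesis cocycle : forall g h k,
  (c h k + c g (h * k)%g = c (g * h)%g k + c g h)%R.

Local Open Scope ring_scope.

Definition cext_mul (a b : B * G) : B * G :=
  (a.1 + b.1 + c a.2 b.2, (a.2 * b.2)%g).
(** The cocycle is not assumed to be normalized: c(1, 1) is what c takes
whenever one of its arguments is 1. *)
Definition cext_one : B * G := (- c 1%g 1%g, 1%g).
Definition cext_inv (a : B * G) : B * G :=
  (- a.1 - c a.2^-1%g a.2 - c 1%g 1%g, a.2^-1%g).

Lemma cocycle1l g : c 1%g g = c 1%g 1%g.
Proof. by have := cocycle 1 1 g; rewrite !mul1g => /addrI. Qed.

Lemma cocycle1r g : c g 1%g = c 1%g 1%g.
Proof. by have := cocycle g 1 1; rewrite !mulg1 addrC => /addrI->. Qed.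

Lemma cocycleV g : c g g^-1%g = c g^-1%g g.
Proof.
have := cocycle g g^-1 g.
by rewrite mulVg mulgV cocycle1l cocycle1r addrC => /addrI.
Qed.

Fact cext_mulA : associative cext_mul.
Proof.
move=> [a g] [b h] [d k]; rewrite /cext_mul /= mulgA; congr pair.
by rewrite -!addrA cocycle !addrA [LHS](ACl (1 * 2 * 5 * 3 * 4)).
Qed.

Fact cext_mul1 : left_id cext_one cext_mul.
Proof.
by move=> [a g]; rewrite /cext_mul /= cocycle1l mul1g addrAC addNr add0r.
Qed.

Fact cext_mulr1 : right_id cext_one cext_mul.
Proof. by move=> [a g]; rewrite /cext_mul /= cocycle1r mulg1 subrK. Qed.

Fact cext_mulV : left_inverse cext_one cext_inv cext_mul.
Proof.
move=> [a g]; rewrite /cext_mul /cext_one /= mulVg; congr pair.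
by rewrite [LHS](ACl ((1 * 4) * (2 * 5) * 3)) /= !addNr !add0r.
Qed.

Fact cext_mulrV : right_inverse cext_one cext_inv cext_mul.
Proof.
move=> [a g]; rewrite /cext_mul /cext_one /= mulgV cocycleV; congr pair.
by rewrite !addrA [LHS](ACl ((1 * 2) * (3 * 5) * 4)) /= subrr addNr !add0r.
Qed.

Local Close Scope ring_scope.

(** The embedding i of B is shifted by c(1, 1) to make it multiplicative. *)
Lemma cocycle_extension : exists (U : groupType) (p : {multiplicative U -> G})
    (s : G -> U) (i : B -> U),
  [/\ cancel s p, injective i, {morph i : a b / (a + b)%R >-> a * b},
      forall a k, commute (i a) k &
      (forall z, p z = 1 -> exists a, z = i a) /\
      forall g h, s g * s h = i (c g h) * s (g * h)].
Proof.
pose U_isGroup := isGroup.Build (B * G)%type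
  cext_mulA cext_mul1 cext_mulr1 cext_mulV cext_mulrV.
pose U : groupType := HB.pack (B * G)%type U_isGroup.
pose p_hom := isMultiplicative.Build U G (fun a => a.2) (fun _ _ => erefl).
pose p : {multiplicative U -> G} := HB.pack (fun a : U => a.2) p_hom.
exists U, p, (fun g => (0%R, g)), (fun a => ((a - c 1 1)%R, 1)).
split=> // [a b [] /addIr //|a b|a [b g]|]; last split=> [[a g] /= ->|g h].
- rewrite /mul /= /cext_mul /= mulg1; congr pair.
  by rewrite -[RHS]addrA subrK addrAC.
- rewrite /commute /mul /= /cext_mul /= mulg1 mul1g cocycle1l cocycle1r.
  by rewrite [(b + _)%R]addrC.
- by exists (a + c 1 1)%R; rewrite addrK.
rewrite /mul /= /cext_mul /= mul1g cocycle1l addr0; congr pair.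
by rewrite addr0 subrK add0r.
Qed.

End CocycleExtension.

Section TorsionFree.
Variable G : groupType.
Local Open Scope ring_scope.
Local Notation bar g h := (<< (g%g, h%g) >> : bar2 G).

Definition bar_boundary : {pred bar2 G} :=
  fun z => `[< exists y : bar3 G, bar_d3 y = z >].

Fact bar_boundary_zmod_closed : zmod_closed bar_boundary.
Proof.
split=> [|_ _ /asboolP[y <-] /asboolP[z <-]]; apply/asboolP.
  by exists 0; rewrite raddf0.
by exists (y - z); rewrite raddfB.
Qed.
HB.instance Definition _ :=
  GRing.isZmodClosed.Build (bar2 G) bar_boundary bar_boundary_zmod_closed.

(** The group of 2-chains modulo boundaries, of which H_2(G) is a subgroup and
in which the bar symbols form the universal cocycle. *)
Definition bar_quot : zmodType := Quotient.quot bar_boundary.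
Definition bar_class (z : bar2 G) : bar_quot :=
  (\pi_(Quotient.quot bar_boundary) z)%qT.

Lemma bar_classD : {morph bar_class : y z / y + z}.
Proof. by move=> y z; rewrite /bar_class -pi_addr. Qed.

Lemma quot_class_eq0 (V : zmodType) (I : zmodClosed V) (z : V) :
  (\pi_(Quotient.quot I) z)%qT = 0 <-> z \in I.
Proof.
have -> : (0 = \pi_(Quotient.quot I) 0)%qT by rewrite raddf0.
by split=> [/eqP|zI]; [|apply/eqP]; rewrite -Quotient.idealrBE subr0.
Qed.

Lemma bar_class_eq0 z : bar_class z = 0 <-> exists y : bar3 G, bar_d3 y = z.
Proof.
by split=> [/quot_class_eq0/asboolP //|zb]; apply/quot_class_eq0/asboolP.
Qed.

Lemma H2_torsion_free_cycle (z : bar2 G) (n : nat) : torsion_free (H2 G) ->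
    bar_d2 z = 0 -> (0 < n)%N -> (exists y, bar_d3 y = z *+ n) ->
  exists y, bar_d3 y = z.
Proof.
move=> tf /eqP dz n_gt0 [y yE]; pose w : cycle2 G := Cycle2 dz.
suff /quot_class_eq0/asboolP :
  (\pi_(Quotient.quot (@boundary2 G)) w)%qT = 0 by [].
apply: tf n_gt0 _; rewrite -raddfMn; apply/quot_class_eq0/asboolP.
by exists y; rewrite yE -[RHS]/(val (w *+ n)) raddfMn.
Qed.

(** Two groups are compared through the same cycle w: the universal cocycle
extension, which detects the homology class of w, and a crossed pair over T,
which detects t. *)
Lemma exterior_torsion_free (t : exterior_square G) (n : nat) :
  torsion_free (H2 G) -> ext_boundary G t = 1%g -> (0 < n)%N ->
  (t ^+ n = 1)%g -> t = 1%g.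
Proof.
move=> tf dt n_gt0 tn; have [z [S [dz zP]]] := wedge_factor_map t.
rewrite dt in dz zP.
pose w := z + bar 1 1.
have jE (K : groupType) (p : {multiplicative K -> G})
    (j : {multiplicative exterior_square G -> K}) s F :
  crossed p j -> factor_map p s F -> section_on (1%g :: S) p s -> j t = F w.
  move=> pj sF sS; rewrite (zP K p j s F) //; last first.
    by move=> g gS; apply: sS; rewrite inE gS orbT.
  rewrite (factor_map_section1 sF) -?(factor_mapD sF) // => g.
  by rewrite inE => /eqP->; apply: sS; rewrite inE eqxx.
(* The universal cocycle shows that n w is a boundary. *)
have [y yE] : exists y, bar_d3 y = w.
  apply: (H2_torsion_free_cycle tf _ n_gt0).
    by rewrite raddfD /= dz bar_d2U mulg1 subrr add0r addNr.
  apply/bar_class_eq0.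
  have [|U [p [s [i [ps i_inj iD iC [kerp sM]]]]]] :=
    @cocycle_extension G bar_quot (fun g h => bar_class (bar g h)).
    move=> g h k; rewrite -!bar_classD.
    apply/eqP; rewrite -subr_eq0 -raddfB; apply/eqP/bar_class_eq0.
    exists << (g, h, k) >>; rewrite bar_d3U opprD addrA.
    by rewrite [RHS](ACl (1 * 3 * 2 * 4)).
  have [g|u k /kerp[a ->]|j pj] := @central_crossed G U p.
  - by exists (s g).
  - exact: iC.
  have sF : factor_map p s (i \o bar_class).
    by split=> [y y'|y k|g h _] /=; rewrite ?bar_classD ?iD.
  have /(congr1 (fun u => u ^+ n)%g) := jE U p j s _ pj sF (fun g _ => ps g).
  rewrite -groupfX tn groupf1 => Fw.
  have FX m : i (bar_class (w *+ m)) = (i (bar_class w) ^+ m)%g.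
    elim: m => [|m IHm]; first exact: (factor_map0 sF).
    by rewrite mulrS expgS -IHm; exact: (factor_mapD sF).
  have : i (bar_class (w *+ n)) = i (bar_class 0).
    by rewrite FX -Fw; apply/esym/(factor_map0 sF).
  by move=> /i_inj->; rewrite /bar_class raddf0.
(* Since w = d3(y), its value is trivial in a group that contains T. *)
have [S' S'P] := factor_map_boundary y.
have [E [p [j [pj j_inj pS]]]] := crossed_embedding ((1%g :: S) ++ S').
have /choice[s sP] : forall g, exists e, g \in (1%g :: S) ++ S' -> p e = g.
  move=> g; have [/pS[e]|] := boolP (g \in (1%g :: S) ++ S'); first by exists e.
  by exists 1%g.
have [F sF] := factor_map_exists s pj.
apply: j_inj; rewrite groupf1 (jE E p j s F) //; last first.
  by move=> g gS; apply: sP; rewrite mem_cat gS.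
rewrite -yE; apply: (S'P E p s F) => // g gS.
by apply: sP; rewrite mem_cat gS orbT.
Qed.

End TorsionFree.

(** * Orders from a kernel and an image *)

Section PositiveCone.
Variables (T : groupType) (N : T -> Prop).
Hypotheses (NM : forall x y, N x -> N y -> N (x * y))
  (N_comm : forall x y, N x -> N y -> commute x y)
  (N_torsion_free : forall x n, N x -> (0 < n)%N -> x ^+ n = 1 -> x = 1).

(** The candidates for the set of positive elements of an order on N; a maximal
one contains x or x^-1 for each nontrivial x in N. *)
Definition strict_semigroup (A : set T) :=
  [/\ forall x, A x -> N x, forall x y, A x -> A y -> A (x * y) & ~ A 1].

(** By maximality the semigroup generated by A and x contains 1. A relation
a x^n = 1 that witnesses this must involve an element a of A, since x is not
torsion. *)
Lemma strict_semigroup_adjoin (A : set T) x :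
    strict_semigroup A -> N x -> x <> 1 ->
    (forall B : set T, (A `<` B)%classic -> ~ strict_semigroup B) ->
    ~ A x -> exists2 n, (0 < n)%N & A (x ^- n).
Proof.
move=> [AN AM A1] Nx x1 Amax Ax; apply: contrapT => noA.
have NX n : (0 < n)%N -> N (x ^+ n).
  by elim: n => // -[|n] IHn _ //; rewrite expgS; apply: NM => //; exact: IHn.
pose B : set T := fun b =>
  A b \/ exists a n, [/\ A a \/ a = 1, (0 < n)%N & b = a * x ^+ n].
apply: (Amax B); first split.
- by move=> a Aa; left.
- move=> /(_ x) BA; apply/Ax/BA; right; exists 1, 1%N.
  by split; [right| |rewrite mul1g].
split=> [_ [/AN //|[a [n [[Aa|->] n0 ->]]]]|b c|].
- by apply: NM; [exact: AN|exact: NX].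
- by rewrite mul1g; exact: NX.
- have A1M a a' : A a \/ a = 1 -> A a' \/ a' = 1 -> A (a * a') \/ a * a' = 1.
    move=> [Aa|->] [Aa'|->]; rewrite ?mulg1 ?mul1g; try by [left|right].
    by left; exact: AM.
  have A1C a n : A a \/ a = 1 -> (0 < n)%N -> commute (x ^+ n) a.
    move=> [Aa|->] n0; last exact: commute1.
    by apply: N_comm; [exact: NX|exact: AN].
  move=> [Ab|[a [n [Aa n0 ->]]]] [Ac|[a' [m [Aa' m0 ->]]]].
  + by left; exact: AM.
  + right; exists (b * a'), m; split=> //; last by rewrite mulgA.
    by apply: A1M => //; left.
  + right; exists (a * c), n; split=> //; first by apply: A1M => //; left.
    by rewrite -!mulgA (A1C c n) //; left.
  + right; exists (a * a'), (n + m)%N; split; first exact: A1M.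
      by rewrite addn_gt0 n0.
    by rewrite expgnDr !mulgA -[a * _ * a']mulgA (A1C a' n) // mulgA.
- case=> [//|[a [n [[Aa|->] n0]]]].
    move=> /esym/eqP; rewrite mulg_eq1 => /eqP aE.
    by apply: noA; exists n; rewrite -?aE.
  by rewrite mul1g => /esym/(N_torsion_free Nx n0).
Qed.

Hypothesis NV : forall x, N x -> N x^-1.

(** If neither x nor x^-1 lies in a maximal A, then x^-n and x^m lie in A for
some positive n and m, hence so does x^-nm x^nm = 1. *)
Lemma positive_cone : exists A : set T,
  strict_semigroup A /\ forall x, N x -> x <> 1 -> A x \/ A x^-1.
Proof.
have [F FN Ftot|A [Acone Amax]] := @Zorn_bigcup T strict_semigroup.
  split=> [x [A FA Ax]|x y [A FA Ax] [B FB By]|[A FA A1]].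
  - by have [AN _ _] := FN _ FA; exact: AN.
  - have [AB|BA] := Ftot A B FA FB.
      by exists B => //; have [_ BM _] := FN _ FB; apply: BM => //; exact: AB.
    by exists A => //; have [_ AM _] := FN _ FA; apply: AM => //; exact: BA.
  - by have [_ _] := FN _ FA.
exists A; split=> // x Nx x1; have [AN AM A1] := Acone.
have [Ax|nAx] := pselect (A x); first by left.
have [AVx|nAVx] := pselect (A x^-1); first by right.
have [n n0 An] := strict_semigroup_adjoin Acone Nx x1 Amax nAx.
have xV1 : x^-1 <> 1 by move=> /eqP; rewrite invg_eq1 => /eqP.
have [m m0 Am] := strict_semigroup_adjoin Acone (NV Nx) xV1 Amax nAVx.
have AX y k : A y -> (0 < k)%N -> A (y ^+ k).
  move=> Ay; elim: k => // -[|k] IHk _ //.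
  by rewrite expgS; apply: AM => //; exact: IHk.
case: A1; have := AM _ _ (AX _ m An m0) (AX _ n Am n0).
by rewrite [x^-1 ^+ m]expVgn invgK expVgn expgnAC mulVg.
Qed.

End PositiveCone.

Section Lexicographic.
Variables (T K : groupType) (l : {multiplicative T -> K}) (P : T -> Prop).
Hypotheses (P_ker : forall x, P x -> l x = 1)
  (PM : forall x y, P x -> P y -> P (x * y)) (P1 : ~ P 1)
  (P_total : forall x, l x = 1 -> x <> 1 -> P x \/ P x^-1).

(* A strict partial order on T, total on each fibre of l and void between
fibres. *)
Local Notation below x y := (P (x^-1 * y)).

Lemma below_trans y x z : below x y -> below y z -> below x z.
Proof. by move=> xy /(PM xy); rewrite mulgA mulgK. Qed.

Lemma below_irr x : ~ below x x.
Proof. by rewrite mulVg. Qed.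

Lemma below_fibre x y : below x y -> l x = l y.
Proof.
by move=> /P_ker/eqP; rewrite gmulfM groupfV mulg_eq1 eqg_inv => /eqP.
Qed.

Lemma below_total x y : l x = l y -> [\/ x = y, below x y | below y x].
Proof.
move=> xy; have [->|/eqP xNy] := eqVneq x y; first by constructor 1.
have [||Pxy|Pyx] := @P_total (x^-1 * y).
- by rewrite gmulfM groupfV xy mulVg.
- by move=> /eqP; rewrite mulg_eq1 eqg_inv => /eqP.
- by constructor 2.
- by constructor 3; rewrite invgM invgK in Pyx.
Qed.

Lemma left_orderable_lex : left_orderable K -> left_orderable T.
Proof.
move=> [lt [lt_irr lt_trans lt_total ltM]].
exists (fun x y => lt (l x) (l y) || `[< below x y >]); split.
- by move=> x; rewrite lt_irr; apply/asboolP; exact: below_irr.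
- move=> y x z /orP[xy|/asboolP xy] /orP[yz|/asboolP yz].
  + by rewrite (lt_trans _ _ _ xy yz).
  + by rewrite -(below_fibre yz) xy.
  + by rewrite (below_fibre xy) yz.
  + by apply/orP; right; apply/asboolP; exact: below_trans yz.
- move=> x y xNy; have [lxy|/eqP/lt_total/orP[->|->]] := pselect (l x = l y).
  + have [xy|xy|yx] := below_total lxy; first by rewrite xy eqxx in xNy.
      by apply/orP; left; apply/orP; right; apply/asboolP.
    by apply/orP; right; apply/orP; right; apply/asboolP.
  + by [].
  + by rewrite orbT.
move=> h x y; rewrite !gmulfM invgM -!mulgA mulKg.
have [/(ltM (l h)) lxy|nlxy] := boolP (lt (l x) (l y)).
  by rewrite lxy.
suff /negbTE-> : ~~ lt (l h * l x) (l h * l y) by [].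
by apply: contra nlxy => hlxy; apply/(ltM (l h)).
Qed.

Definition below_sign x y : int :=
  if `[< below x y >] then 1%R else if `[< below y x >] then (-1)%R else 0%R.

Variant below_sign_spec x y : int -> int -> Prop :=
| BelowLt of below x y : below_sign_spec x y 1%R (-1)%R
| BelowGt of below y x : below_sign_spec x y (-1)%R 1%R
| BelowEq of x = y : below_sign_spec x y 0%R 0%R
| BelowFar of l x <> l y : below_sign_spec x y 0%R 0%R.

Lemma below_signP x y : below_sign_spec x y (below_sign x y) (below_sign y x).
Proof.
rewrite /below_sign; case: asboolP => [xy|nxy].
  case: asboolP => [yx|_]; last by constructor.
  by have := below_irr (below_trans xy yx).
case: asboolP => [yx|nyx]; first by constructor.
have [lxy|] := pselect (l x = l y); last by constructor.
by have [xy||] := below_total lxy; [constructor 3| |].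
Qed.

Lemma below_signN x y : below_sign y x = (- below_sign x y)%R.
Proof. by case: below_signP; rewrite ?opprK ?oppr0. Qed.

Lemma below_signM h x y : below_sign (h * x) (h * y) = below_sign x y.
Proof. by rewrite /below_sign !invgM -!mulgA !mulKg. Qed.

(** On a fibre of l this is the circular order of the linear order [below], and
it is the coboundary of [below_sign]; adding it to the pullback of a circular
order therefore preserves the cocycle condition. As [below_sign] vanishes
between fibres, the same formula serves for triples that meet one, two or three
fibres. *)
Definition below_cycle x y z : int :=
  (below_sign x y + below_sign y z + below_sign z x)%R.

Definition circular_value (x y z : T) (n : int) :=
  n \in [:: (-1)%R; 0%R; 1%R] /\ (n = 0%R <-> [\/ x = y, x = z | y = z]).

Lemma circular_value_rot x y z n :
  circular_value x y z n -> circular_value y z x n.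
Proof.
move=> [n_val nE]; split=> //; rewrite nE.
by split=> -[] e; [constructor 2|constructor 3|constructor 1
                  |constructor 3|constructor 1|constructor 2].
Qed.

Lemma below_cycleC x y z : below_cycle y x z = (- below_cycle x y z)%R.
Proof.
rewrite /below_cycle (below_signN x y) (below_signN z x) (below_signN y z).
by rewrite !opprD addrAC.
Qed.

Lemma circular_valueN x y z n :
  circular_value x y z n -> circular_value y x z (- n)%R.
Proof.
move=> [n_val nE]; split.
  by move: n_val; rewrite !inE => /or3P[] /eqP->; rewrite ?opprK ?oppr0.
have -> : [\/ y = x, y = z | x = z] <-> [\/ x = y, x = z | y = z].
  by split=> -[] e; [constructor 1|constructor 3|constructor 2
                    |constructor 1|constructor 3|constructor 2].
by rewrite -nE; split=> [/eqP|->]; rewrite ?oppr0 // oppr_eq0 => /eqP.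
Qed.

Lemma below_neq x y : below x y -> x <> y.
Proof. by move=> xy e; apply: (@below_irr x); rewrite {2}e. Qed.

Lemma below_sign_lt x y : below x y -> below_sign x y = 1%R.
Proof. by rewrite /below_sign; case: asboolP. Qed.

Lemma below_sign_far x y : l x <> l y -> below_sign x y = 0%R.
Proof.
by move=> xy; case: (below_signP x y) => // /below_fibre => [|/esym] /xy.
Qed.

Lemma circular_value_neq x y z n : n \in [:: (-1)%R; 1%R] ->
  x <> y -> x <> z -> y <> z -> circular_value x y z n.
Proof.
move=> n_val xy xz yz; split.
  by move: n_val; rewrite !inE => /orP[]->; rewrite ?orbT.
by split=> [n0|[]//]; move: n_val; rewrite n0 !inE.
Qed.

Lemma circular_value_eq x y z :
  [\/ x = y, x = z | y = z] -> circular_value x y z 0%R.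
Proof. by []. Qed.

Lemma circular_value_below x y z :
  below x y -> circular_value x y z (below_cycle x y z).
Proof.
move=> xy; have xNy := below_neq xy; have lxy := below_fibre xy.
rewrite /below_cycle (below_sign_lt xy) (below_signN x z).
case: (below_signP y z) => [yz|zy|<-|lyz].
- have xz := below_trans xy yz; rewrite (below_sign_lt xz) addrK.
  by apply: circular_value_neq => //; exact: below_neq.
- rewrite subrr sub0r; have zNy := below_neq zy.
  case: (below_signP x z) => [xz|zx|xz|].
  + by apply: circular_value_neq => // [|/esym//]; exact: below_neq.
  + rewrite opprK; apply: circular_value_neq => // /esym //; exact: below_neq.
  + by rewrite oppr0; apply: circular_value_eq; constructor 2.
  + by rewrite lxy (below_fibre zy).
- rewrite (below_sign_lt xy) addr0 subrr.
  by apply: circular_value_eq; constructor 3.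
- rewrite below_sign_far ?lxy // oppr0 !addr0.
  by apply: circular_value_neq => // [xz|yz]; apply: lyz; rewrite -?xz ?lxy ?yz.
Qed.

(** A triple with two entries in one fibre; the third entry may lie anywhere.
*)
Lemma below_cycle_fibre x y z :
  l x = l y -> circular_value x y z (below_cycle x y z).
Proof.
move=> /below_total[<-|xy|yx].
- rewrite /below_cycle (below_signN x z).
  have -> : below_sign x x = 0%R by case: below_signP => // /below_irr.
  by rewrite add0r subrr; split=> //; split=> // _; constructor 1.
- exact: circular_value_below.
- by rewrite below_cycleC; apply/circular_valueN/circular_value_below.
Qed.

(** A triple either has distinct images in K, where the signs vanish, or has two
entries in one fibre, where the pulled-back circular order vanishes. *)
Lemma circularly_orderable_lex :
  circularly_orderable K -> circularly_orderable T.
Proof.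
move=> [c [c_val c0 c_cocycle cM]].
have valP x y z :
    circular_value x y z (c (l x) (l y) (l z) + below_cycle x y z)%R.
  have [/c0 lE|c_neq0] := pselect (c (l x) (l y) (l z) = 0%R).
    rewrite (_ : c _ _ _ = 0%R) ?add0r; last exact/c0.
    case: lE => lE; first exact: below_cycle_fibre.
      rewrite (_ : below_cycle x y z = below_cycle z x y); last first.
        by rewrite /below_cycle [RHS](ACl (2 * 3 * 1)).
      by apply: circular_value_rot; apply: below_cycle_fibre.
    rewrite (_ : below_cycle x y z = below_cycle y z x); last first.
      by rewrite /below_cycle [RHS](ACl (3 * 1 * 2)).
    by do 2!apply: circular_value_rot; apply: below_cycle_fibre.
  have lxy : l x <> l y by move=> e; apply/c_neq0/c0; constructor 1.
  have lxz : l x <> l z by move=> e; apply/c_neq0/c0; constructor 2.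
  have lyz : l y <> l z by move=> e; apply/c_neq0/c0; constructor 3.
  rewrite /below_cycle !below_sign_far // ?addr0; last exact/nesym.
  apply: circular_value_neq; last 3 first.
  - by move=> e; apply: lxy; rewrite e.
  - by move=> e; apply: lxz; rewrite e.
  - by move=> e; apply: lyz; rewrite e.
  have := c_val (l x) (l y) (l z); rewrite !inE => /or3P[->//|/eqP//|->].
  by rewrite orbT.
exists (fun x y z => c (l x) (l y) (l z) + below_cycle x y z)%R; split.
- by move=> x y z; have [] := valP x y z.
- by move=> x y z; have [] := valP x y z.
- move=> x y z t; rewrite /below_cycle.
  have := c_cocycle (l x) (l y) (l z) (l t).
  rewrite (below_signN x t) (below_signN x z) (below_signN y t).
  move: (c _ _ _) (c _ _ _) (c _ _ _) (c _ _ _) => c1 c2 c3 c4.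
  move: (below_sign _ _) (below_sign _ _) (below_sign _ _) (below_sign _ _).
  move: (below_sign _ _) (below_sign _ _) => s1 s2 s3 s4 s5 s6; lia.
- by move=> h x y z; rewrite !gmulfM -cM /below_cycle !below_signM.
Qed.

End Lexicographic.

Theorem theorem3p4 (G A K : groupType)
    (i : {multiplicative A -> K}) (p : {multiplicative K -> G})
    (H2_torsion_free : torsion_free (H2 G))
    (K_ext : central_extension i p) :
  (circularly_orderable K -> circularly_orderable (exterior_square G)) /\
  (left_orderable K -> left_orderable (exterior_square G)).
Proof.
have [_ p_surj p_ker iC] := K_ext.
have [|j pj] := central_crossed p_surj.
  by move=> z k /p_ker[a <-]; exact: iC.
have p_j t : p (j t) = ext_boundary G t.
  apply: (@exterior_hom_eq _ _ (p \o j)) => g h /=.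
  have [x <-] := p_surj g; have [y <-] := p_surj h.
  have := congr1 p (pj x y); rewrite !gmulfM (ext_boundaryP (p x)).
  by move=> /mulIg/mulIg.
have j_ker t : j t = 1 -> ext_boundary G t = 1.
  by rewrite -p_j => ->; exact: groupf1.
have [||||P [[P_ker PM P1] P_total]] :=
    @positive_cone (exterior_square G) (fun t => j t = 1).
- by move=> t u jt ju; rewrite gmulfM jt ju mulg1.
- move=> t u /j_ker dt _.
  exact: (crossed_ker_central (@crossed_ext_boundary G)).
- move=> t n /j_ker dt n_gt0 tn.
  exact: exterior_torsion_free H2_torsion_free dt n_gt0 tn.
- by move=> t jt; rewrite groupfV jt invg1.
split; first exact: circularly_orderable_lex P_ker PM P1 P_total.
exact: left_orderable_lex P_ker PM P1 P_total.
Qed.
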